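(* Let $n\ge2$ and let $\sigma\in S_n$ be chosen uniformly at random. Then \[ \mathbb{E}[\mathrm{des}(\mathrm{runsort}(\sigma))]=\mathbb{E}[\mathrm{peaks}(\mathrm{runsort}(\sigma))]=\mathbb{E}[\mathrm{peaks}(\sigma)]=\frac{n-2}{3}. \]
   Context: For $\tau\in S_n$ in one-line notation, $\mathrm{des}(\tau)$ is the number of $k\in[n-1]$ with $\tau(k)>\tau(k+1)$, and $\mathrm{peaks}(\tau)$ is the number of $i$ with $1<i<n$ and $\tau(i-1)<\tau(i)>\tau(i+1)$. The runs of $\sigma$ are its maximal increasing contiguous subwords, and $\mathrm{runsort}(\sigma)$ is obtained by rearranging the runs of $\sigma$ in lexicographic order (increasing first entries). *)

(* Defs.v *)
From HB Require Import structures.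
From mathcomp Require Import all_boot all_order all_algebra all_fingroup.

Set Implicit Arguments.
Unset Strict Implicit.
Unset Printing Implicit Defensive.

Import Order.TTheory GRing.Theory Num.Theory.

(* Conventions: 'S_n is the group of permutations of {0, .., n-1}, so both the
   positions and the values of one-line notation are 0-based; only their
   relative order matters below. *)

Section Words.
Context {d : Order.disp_t} {T : orderType d}.
Implicit Types (w : seq T).

(* A letter joins the run that follows it exactly when it is smaller than the
   first letter of that run, so that the runs are maximal: see [runs_maximal]. *)
Fixpoint runs w : seq (seq T) :=
  if w is x :: w' then
    match runs w' with
    | (y :: r) :: rs =>
        if (x < y)%O then (x :: y :: r) :: rs else [:: x] :: (y :: r) :: rs
    | _ => [:: [:: x]]
    end
  else [::].

Definition runsort_word w : seq T :=
  flatten (sort (fun u v : seqlexi T => (u <= v)%O) (runs w)).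

Lemma runs_neq_nil w : all (fun r => r != [::]) (runs w).
Proof.
elim: w => //= x w; case: (runs w) => [|[|y r] rs] //=.
by move=> h; case: ifP => _ /=.
Qed.

Lemma flatten_runs w : flatten (runs w) = w.
Proof.
elim: w => //= x w; have := runs_neq_nil w.
case: (runs w) => [|[|y r] rs] //= _ <- //.
by case: ifP.
Qed.

Lemma runs_increasing w : all (sorted (fun x y => (x < y)%O)) (runs w).
Proof.
elim: w => //= x w; case: (runs w) => [|[|y r] rs] //= /andP[hr hrs].
by case: ifP => /= [->|_]; rewrite hr hrs.
Qed.

Lemma runs_maximal w x0 :
  sorted (fun u v => (head x0 v <= last x0 u)%O) (runs w).
Proof.
elim: w => //= x w.
case: (runs w) => [|[|y r] rs] //= h.
by case: ltP => /= [_|->] //; case: rs h.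
Qed.

Lemma perm_runsort_word w : perm_eq (runsort_word w) w.
Proof.
rewrite -{2}(flatten_runs w); apply: perm_flatten.
by rewrite perm_sort.
Qed.

End Words.

Section Permutations.
Variable n : nat.
Implicit Types (s : 'S_n).

Definition oneline s : n.-tuple 'I_n := [tuple s i | i < n].

Definition entry s (k : nat) : nat := nth 0 [seq val x | x <- oneline s] k.

Definition des s : nat :=
  #|[set k : 'I_n | (k.+1 < n) && (entry s k > entry s k.+1)]|.

Definition peaks s : nat :=
  #|[set i : 'I_n | [&& 0 < i, i.+1 < n,
       entry s i.-1 < entry s i & entry s i > entry s i.+1]]|.

Lemma size_runsort_word s : size (runsort_word (oneline s)) == n.
Proof. by rewrite (perm_size (perm_runsort_word _)) size_tuple. Qed.

Definition runsort_tuple s : n.-tuple 'I_n := Tuple (size_runsort_word s).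

Lemma runsort_tuple_inj s : injective (tnth (runsort_tuple s)).
Proof.
apply/tuple_uniqP; rewrite (perm_uniq (perm_runsort_word _)).
by rewrite map_inj_uniq ?enum_uniq //; apply: perm_inj.
Qed.

Definition runsort s : 'S_n := perm (@runsort_tuple_inj s).

Lemma oneline_runsort s :
  oneline (runsort s) = runsort_word (oneline s) :> seq 'I_n.
Proof.
suff -> : oneline (runsort s) = runsort_tuple s by [].
by apply: eq_from_tnth => i; rewrite tnth_mktuple permE.
Qed.

Local Open Scope ring_scope.

(* Expectation of X(sigma) for sigma uniformly distributed in S_n. *)
Definition expect (X : 'S_n -> nat) : rat :=
  (\sum_(s : 'S_n) (X s)%:R) / #|[set: 'S_n]|%:R.

End Permutations.

(* Main.v *)
Require Import Defs.
From HB Require Import structures.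
From mathcomp Require Import all_boot all_order all_algebra all_fingroup.
From mathcomp Require Import zify ring.

(* Write sigma as a word on 1, .., n preceded by the sentinel 0, and let f c be
   the nearest letter to the left of c that is smaller than c.  This encodes
   permutations bijectively as arbitrary maps with f c < c (increasing trees
   rooted at 0).  A letter c continues a run ([nonhead]) exactly when f c <> 0
   and c is the largest child of f c, its predecessor in the run then being f c;
   a letter ends a run exactly when it is a leaf.

   After sorting, consecutive runs create a descent exactly when the run (h .. z)
   being left contains, strictly between h and z, the first letter of another
   run; each descent is preceded by an ascent, so descents and peaks agree.
   Hence for each leaf z continuing a run one subtracts the trees for which the
   first letter a of the run of z is the largest first letter below z.  With
   E a := [reach a z] (no first letter in (a, z], and a is an f-ancestor of z),
   the number of these is the sum over 0 < a < z of #{E a, a is a first letter}.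
   Exchanging the labels a and a-1 as values of f at arguments > a is an
   involution ([hoist]) that matches {E a, a is not a first letter} with
   E (a-1), so the sum telescopes to #E (z-1) = (z-1) (n-2)!, against
   (z-1)^2 (n-2)! leaves continuing a run.  Summing (z-1)(z-2)(n-2)! over z
   gives n! (n-2)/3.  For sigma itself, the largest of three consecutive entries
   is the middle one in a third of the permutations. *)

Set Implicit Arguments.
Unset Strict Implicit.
Unset Printing Implicit Defensive.

Import Order.TTheory GRing.Theory Num.Theory.

(** * Run-sorted words *)

Section SortedRuns.
Context {d : Order.disp_t} {T : orderType d}.
Implicit Types (x : T) (w r : seq T) (rs : seq (seq T)).

Fixpoint descents w : nat :=
  if w is x :: w' then
    (if w' is y :: _ then (y < x)%O else false) + descents w'
  else 0.

Definition head_lt x0 : rel (seq T) := fun r1 r2 => (head x0 r1 < head x0 r2)%O.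

(** The order of [rs] is irrelevant here, so the descents created by sorting can be read off the
    unsorted runs. *)
Definition straddled x0 rs r : bool :=
  has (fun r2 => (head x0 r < head x0 r2 < last x0 r)%O) rs.

Lemma descents_cat x r w x0 : path <%O x r ->
  descents ((x :: r) ++ w) = (w != [::]) && (head x0 w < last x r)%O + descents w.
Proof.
elim: r x => [|y r IH] x; first by case: w.
by case/andP => xy /IH; rewrite /= => ->; rewrite ltNge (ltW xy).
Qed.

Lemma head_flatten x0 rs : all (fun r => r != [::]) rs ->
  head x0 (flatten rs) = head x0 (head [::] rs).
Proof. by case: rs => [|[|? ?] ?]. Qed.

(** Runs increase, so a descent can only sit at a junction, where the next head lies below the last
    letter of [r]. Heads increase along [rs], so if any head lies strictly between the head and the
    last letter of [r], the next one does. *)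
Lemma descents_flatten x0 rs : all (fun r => r != [::]) rs ->
  all (sorted <%O) rs -> pairwise (head_lt x0) rs ->
  descents (flatten rs) = count (straddled x0 rs) rs.
Proof.
elim: rs => //= r rs IH /andP[r0 rs0] /andP[sr srs] /andP[hr prs].
case: r r0 sr hr => //= h t _ sr hr.
rewrite -[LHS]/(descents ((h :: t) ++ flatten rs)) (descents_cat _ x0) // IH //; congr (_ + _); last first.
  apply: eq_in_count => r /(allP hr); rewrite /head_lt /= => hh.
  by rewrite /straddled /= ltNge (ltW hh).
rewrite /straddled /= ltxx /=; congr nat_of_bool.
rewrite head_flatten //.
case: rs rs0 hr prs {IH srs} => [|r2 rs] //= /andP[r20 _] /andP[hr2 hrs] /andP[h2 _].
have -> : r2 ++ flatten rs != [::] by case: r2 r20 {hr2 h2}.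
rewrite /head_lt /= in hr2; rewrite hr2 /=; case: ltP => //= le.
apply/esym/hasP => -[r /(allP h2)]; rewrite /head_lt => lt2 /andP[_ lt3].
by move: (lt_trans lt2 lt3); rewrite ltNge le.
Qed.

(** A descent at [k] closes a run. Were this run a single letter, the next head would lie below its
    own head, against the order of the heads; so position [k.-1] is in the same run and carries a
    smaller letter. *)
Lemma flatten_descent_peak x0 rs k : all (fun r => r != [::]) rs ->
  all (sorted <%O) rs -> pairwise (head_lt x0) rs ->
  k.+1 < size (flatten rs) ->
  (nth x0 (flatten rs) k.+1 < nth x0 (flatten rs) k)%O ->
  (0 < k) && (nth x0 (flatten rs) k.-1 < nth x0 (flatten rs) k)%O.
Proof.
elim: rs k => //= r rs IH k /andP[r0 rs0] /andP[sr srs] /andP[hr prs].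
rewrite size_cat !nth_cat => szk.
have incr i j : i < j < size r -> (nth x0 r i < nth x0 r j)%O.
  case/andP=> ij jr; apply: (sorted_ltn_nth lt_trans) => //.
  by rewrite inE (ltn_trans ij).
case: (ltngtP k.+1 (size r)) => kr.
- move=> lt1.
  have := incr k k.+1; rewrite ltnSn kr => /(_ isT) lt2.
  by have := lt_trans lt1 lt2; rewrite ltxx.
- rewrite subSn // => lt1.
  have szk' : (k - size r).+1 < size (flatten rs) by move: szk kr; lia.
  have := IH (k - size r) rs0 srs prs szk' lt1.
  case/andP => k0 lt2; have -> : 0 < k by move: k0; lia.
  have -> : (k.-1 < size r) = false by move: k0; lia.
  by have -> : k.-1 - size r = (k - size r).-1 by lia.
rewrite -kr subnn.
case: rs hr rs0 {IH prs srs} szk => [|r2 rs] /=; first by rewrite /=; lia.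
case/andP=> hr2 _ /andP[r20 _] szk.
have -> : nth x0 (r2 ++ flatten rs) 0 = head x0 r2 by case: r2 r20 {hr2 szk}.
move=> lt1; have lt2 : (nth x0 r 0 < nth x0 r k)%O.
  by rewrite nth0; apply: lt_trans lt1.
case: k kr lt1 lt2 {szk} => [|k] kr _ lt2; first by rewrite ltxx in lt2.
by rewrite /= (ltnW (ltnSn k.+1)) /=; apply: incr; rewrite -kr !ltnSn.
Qed.

Lemma uniq_flatten_map rs (F : seq T -> T) : uniq (flatten rs) ->
  {in rs, forall r, F r \in r} -> uniq (map F rs).
Proof.
elim: rs => //= r rs IH; rewrite cat_uniq => /and3P[_ /hasPn nr ur] Fr.
rewrite IH // ?andbT; last by move=> r' r'rs; rewrite Fr // inE r'rs orbT.
apply/mapP=> -[r' r'rs eF]; have := Fr r; rewrite inE eqxx => /(_ isT).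
rewrite eF; apply/negP; apply: nr; apply/flattenP; exists r' => //.
by rewrite Fr // inE r'rs orbT.
Qed.

Lemma head_mem x0 r : r != [::] -> head x0 r \in r.
Proof. by case: r => //= x r _; rewrite inE eqxx. Qed.

Lemma last_mem x0 r : r != [::] -> last x0 r \in r.
Proof. by case: r => //= x r _; rewrite mem_last. Qed.

(** Runs of [w] share no letter, so their heads differ and the lexicographic order is decided by the
    heads alone. *)
Lemma pairwise_sort_runs x0 w : uniq w ->
  pairwise (head_lt x0) (sort (fun u v : seqlexi T => (u <= v)%O) (runs w)).
Proof.
move=> uw; set rs := sort _ _.
have prs : perm_eq rs (runs w) by rewrite perm_sort.
have n0 : all (fun r => r != [::]) rs by rewrite (perm_all _ prs) runs_neq_nil.
have ul : pairwise (fun r1 r2 => head x0 r1 != head x0 r2) rs.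
  rewrite -(pairwise_map (head x0) (fun x y => x != y)) -uniq_pairwise.
  apply: uniq_flatten_map => [|r /(allP n0)]; last exact: head_mem.
  by rewrite (perm_uniq (perm_flatten prs)) flatten_runs.
have sl : pairwise (fun u v : seqlexi T => (u <= v)%O) rs.
  by rewrite -sorted_pairwise ?sort_sorted //; [exact: le_total | exact: le_trans].
elim: rs n0 ul sl {prs} => //= r rs IH /andP[r0 n0] /andP[u1 u2] /andP[l1 l2].
rewrite IH // andbT; apply/allP=> r' r'rs.
rewrite /head_lt lt_neqAle (allP u1) //=.
move: (allP l1 _ r'rs) (allP n0 _ r'rs); case: r r0 {u1 l1} => // x r _.
by case: r' {r'rs} => // y r' /andP[].
Qed.

End SortedRuns.

(** * Invariance of runs and descents under increasing relabelling *)

Section MapRuns.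
Context {d d' : Order.disp_t} {T : orderType d} {T' : orderType d'}.
Variable g : T -> T'.
Hypothesis g_mono : {mono g : x y / (x < y)%O}.

Lemma runs_map w : runs (map g w) = map (map g) (runs w).
Proof.
elim: w => //= x w ->.
by case: (runs w) => [|[|y r] rs] //=; rewrite g_mono; case: ifP.
Qed.

Lemma descents_map w : descents (map g w) = descents w.
Proof. by elim: w => //= x [|y w] //= ->; rewrite g_mono. Qed.

Lemma straddled_map x0 x1 rs : all (fun r => r != [::]) rs ->
  {in rs, forall r,
    straddled x1 (map (map g) rs) (map g r) = straddled x0 rs r}.
Proof.
move=> n0 r rrs; rewrite /straddled has_map; apply: eq_in_has => r2 r2rs.
move: (allP n0 _ rrs) (allP n0 _ r2rs); case: r {rrs} => // x r _.
by case: r2 {r2rs} => // y r2 _ /=; rewrite last_map !g_mono.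
Qed.

Lemma count_straddled_map x0 x1 rs : all (fun r => r != [::]) rs ->
  count (straddled x1 (map (map g) rs)) (map (map g) rs)
    = count (straddled x0 rs) rs.
Proof.
by move=> n0; rewrite count_map; apply: eq_in_count; apply: straddled_map.
Qed.

End MapRuns.

Lemma sum_descents (w : seq nat) :
  \sum_(k < size w) ((k.+1 < size w) && (nth 0 w k.+1 < nth 0 w k)) = descents w.
Proof.
elim: w => [|x w IH] /=; first by rewrite big_ord0.
rewrite big_ord_recl -IH; congr (_ + _).
by case: w {IH}.
Qed.

(** * Descents and peaks of the run-sorted permutation *)

Section Runsort.
Variable n : nat.
Implicit Type s : 'S_n.

Lemma val_ord_mono : {mono (val : 'I_n -> nat) : x y / (x < y)%O}.
Proof. by []. Qed.

Lemma size_entries s : size [seq val x | x <- oneline s] = n.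
Proof. by rewrite size_map size_tuple. Qed.

Lemma des_descents s : des s = descents (oneline s).
Proof.
rewrite -(descents_map val_ord_mono) -sum_descents size_entries /des -sum1dep_card.
by rewrite big_mkcond; apply: eq_bigr => k _; case: ifP.
Qed.

Lemma uniq_oneline s : uniq (oneline s).
Proof. by rewrite map_inj_uniq ?enum_uniq //; apply: perm_inj. Qed.

Lemma sort_runs s
    (rs := sort (fun u v : seqlexi 'I_n => (u <= v)%O) (runs (oneline s))) :
  [/\ perm_eq rs (runs (oneline s)), all (fun r => r != [::]) rs,
      all (sorted <%O) rs & forall x0, pairwise (head_lt x0) rs].
Proof.
have p : perm_eq rs (runs (oneline s)) by rewrite perm_sort.
split=> //; rewrite ?(perm_all _ p) ?runs_neq_nil ?runs_increasing //.
by move=> x0; apply: pairwise_sort_runs; apply: uniq_oneline.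
Qed.

Lemma des_runsort x0 s :
  des (runsort s) = count (straddled x0 (runs (oneline s))) (runs (oneline s)).
Proof.
have [p h1 h2 h3] := sort_runs s.
rewrite des_descents oneline_runsort (descents_flatten (x0 := x0)) //.
rewrite (seq.permP p); apply: eq_count => r; rewrite /straddled.
exact: perm_has.
Qed.

Lemma peaks_runsort s : peaks (runsort s) = des (runsort s).
Proof.
have [p h1 h2 h3] := sort_runs s.
rewrite /peaks /des; congr #|pred_of_set _|; apply/setP=> k; rewrite !inE.
apply/idP/idP=> [/and4P[_ -> _ -> //]|/andP[kn lt]].
have x0 : 'I_n := k.
have E i : i < n -> entry (runsort s) i = nth x0 (runsort_word (oneline s)) i.
  by move=> ilt; rewrite /entry oneline_runsort (nth_map x0) ?(eqP (size_runsort_word s)).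
have := @flatten_descent_peak _ _ x0 _ k h1 h2 (h3 x0).
rewrite -/(runsort_word (oneline s)) (eqP (size_runsort_word s)) => /(_ kn).
rewrite ltEord -!E //; last by apply: leq_ltn_trans (leq_pred _) _.
by move=> /(_ lt)/andP[-> ->]; rewrite kn lt.
Qed.

End Runsort.

(** * Peaks of a uniform permutation *)

Section Peaks.
Variable n : nat.
Implicit Types (s : 'S_n) (p q r : 'I_n).

Lemma entryE s (i : 'I_n) : entry s i = s i.
Proof.
rewrite /entry (nth_map i) ?size_tuple //.
by rewrite -(tnth_nth i (oneline s)) tnth_mktuple.
Qed.

Lemma sum_local_max_swap p q r : p != r -> q != r ->
  \sum_(s : 'S_n) ((s p < s q) && (s r < s q)) = \sum_(s : 'S_n) ((s q < s p) && (s r < s p)).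
Proof.
move=> pr qr; rewrite (reindex_inj (mulgI (tperm p q))) /=.
by apply: eq_bigr => s _; rewrite !permM tpermL tpermR tpermD.
Qed.

(** By swapping positions, the largest of the three entries sits equally often at [p], [q] and [r],
    and each permutation falls into exactly one of these cases. *)
Lemma sum_local_max p q r : p != q -> p != r -> q != r ->
  3 * \sum_(s : 'S_n) ((s p < s q) && (s r < s q)) = n`!.
Proof.
move=> pq pr qr; have C a b c : \sum_(s : 'S_n) ((s a < s b) && (s c < s b))
    = \sum_(s : 'S_n) ((s c < s b) && (s a < s b)).
  by apply: eq_bigr => s _; rewrite andbC.
have e1 := sum_local_max_swap pr qr.
have e2 : \sum_(s : 'S_n) ((s p < s q) && (s r < s q))
    = \sum_(s : 'S_n) ((s p < s r) && (s q < s r)).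
  by rewrite C sum_local_max_swap 1?C // eq_sym.
rewrite 2!mulSn mul1n {2}e1 {2}e2 -!big_split /= -card_Sn -sum1_card.
apply: eq_big => s; first by rewrite inE.
move=> _; have inj a b : a != b -> (s a != s b :> nat).
  by move=> ab; rewrite (inj_eq val_inj) (inj_eq perm_inj).
have := inj _ _ pq; have := inj _ _ pr; have := inj _ _ qr; lia.
Qed.
End Peaks.

Lemma sum_peaks m : 3 * \sum_(s : 'S_m.+2) peaks s = m * (m.+2)`!.
Proof.
rewrite (eq_bigr (fun s : 'S_m.+2 =>
  \sum_(k < m.+2) [&& 0 < k, k.+1 < m.+2, entry s k.-1 < entry s k
                     & entry s k > entry s k.+1])); last first.
  move=> s _; rewrite /peaks -sum1dep_card big_mkcond.
  by apply: eq_bigr => k _; case: ifP.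
(* The two end positions are never peaks. The index [j] that remains stands for position [j + 1],
   with neighbours [j] and [j + 2]. *)
rewrite exchange_big big_ord_recl big_ord_recr /= big1 // add0n.
rewrite [X in _ + X]big1 ?addn0; last first.
  by move=> s _; rewrite /bump /= add1n ltnn.
rewrite big_distrr /= (eq_bigr (fun _ => (m.+2)`!)) ?sum_nat_const ?card_ord //.
move=> j _; pose o i := (inord i : 'I_m.+2).
have oE i : i <= 2 -> o (i + j) = i + j :> nat.
  by move=> i2; rewrite inordK //; have := ltn_ord j; lia.
rewrite -(@sum_local_max _ (o (0 + j)) (o (1 + j)) (o (2 + j))).
- congr (3 * _); apply: eq_bigr => s _.
  rewrite -!entryE !oE // /bump /= !add1n !ltnS.
  by have -> : j < m by [].
all: by apply/eqP=> /(congr1 val) /=; rewrite !oE //; lia.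
Qed.

(** * Increasing trees *)

Section Trees.
Variable n : nat.
Local Notation node := 'I_n.+1.
Implicit Types (f g : {ffun node -> node}) (a b c d v x y z : node).

(** The bound [maxn 1 c] fixes the root, [f 0 = 0], and gives [f c < c] elsewhere, so that trees
    form a product of independent choices. *)
Definition tree f := [forall c : node, f c < maxn 1 c].

Definition nonhead f c :=
  (f c != ord0) && [forall d : node, (c < d) ==> (f d != f c)].

Definition leaf f z := [forall d : node, f d != z].

Definition reach a z : {set {ffun node -> node}} :=
  [set f | [&& tree f, leaf f z,
    [forall c : node, (a < c <= z) ==> nonhead f c] & fconnect f z a]].

(* With [b = a - 1].  If [f a = b] then [a] and [b] are ancestors of the same
   leaves in [reach b z], and exchanging them could stop [a] from being the
   largest child of [b]. *)
Definition hoist a b f : {ffun node -> node} :=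
  if f a == b then f
  else [ffun d : node => if a < d then tperm b a (f d) else f d].

Lemma tree_lt f c : tree f -> 0 < c -> f c < c.
Proof. by move=> /forallP/(_ c); lia. Qed.

Lemma tree_le f c : tree f -> f c <= c.
Proof. by move=> /forallP/(_ c); lia. Qed.

Lemma tree0 f : tree f -> f ord0 = ord0.
Proof. by move=> /forallP/(_ ord0) h; apply: val_inj => /=; move: h => /=; lia. Qed.

Lemma leaf_gt0 f z : tree f -> leaf f z -> 0 < z.
Proof.
move=> /tree0 f0 /forallP/(_ ord0); rewrite f0 -(inj_eq val_inj) /=; lia.
Qed.

Lemma fconnect_le f x y : tree f -> fconnect f x y -> y <= x.
Proof.
move=> tf /iter_findex <-; elim: (findex _ _ _) => //= k IH.
exact: leq_trans (tree_le _ tf) IH.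
Qed.

(** The value at [a] itself is never altered, so the test [f a == b] has the same outcome on the
    image. *)
Lemma hoistK a b : involutive (hoist a b).
Proof.
move=> f; rewrite {2}/hoist; case: eqP => [e|ne]; first by rewrite /hoist e eqxx.
rewrite /hoist ffunE ltnn; case: eqP => // _; apply/ffunP=> d; rewrite !ffunE.
by case: ifP => ad; rewrite ?ad ?tpermK.
Qed.

Lemma hoist_tree a b f : b.+1 = a :> nat -> tree f -> tree (hoist a b f).
Proof.
move=> ba tf; rewrite /hoist; case: ifP => // _; apply/forallP => c; rewrite ffunE.
have := forallP tf c; case: ifP => // ac.
by case: tpermP => [_|_|_ _] //=; lia.
Qed.

Lemma hoist_leaf a b z f : b.+1 = a :> nat -> a < z ->
  leaf f z -> leaf (hoist a b f) z.
Proof.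
move=> ba az lf; rewrite /hoist; case: ifP => // _; apply/forallP => c; rewrite ffunE.
have := forallP lf c; case: ifP => // ac; rewrite -!(inj_eq val_inj) /=.
by case: tpermP => [_|_|_ _] //=; lia.
Qed.

(** Suppose [f a != b]; then [f a < b], so [b] is not the root. For [c > a] one transposition acts
    on the values at [c] and at all larger arguments, so a largest child stays largest and no value
    becomes the root. For [c = a] the value [f a] is neither [a] nor [b]. *)
Lemma hoist_nonhead a b c f : b.+1 = a :> nat -> tree f -> a <= c ->
  nonhead f c -> nonhead (hoist a b f) c.
Proof.
move=> ba tf ac /andP[fc0 /forallP nc]; rewrite /hoist; case: eqP => [e|/eqP ne].
  by rewrite /nonhead fc0; apply/forallP.
have a0 : 0 < a by lia.
have b0 : b != ord0.
  have := tree_lt tf a0; move: ne; rewrite -!(inj_eq val_inj) /=; lia.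
rewrite /nonhead !ffunE; move: ac; rewrite leq_eqVlt => /orP[/eqP/val_inj eac|ac].
  subst c; rewrite ltnn fc0; apply/forallP => d; apply/implyP=> ad; rewrite ffunE ad.
  have := nc d; rewrite ad /=; have := tree_lt tf a0.
  by move: ne; rewrite -!(inj_eq val_inj) /=; case: tpermP => [->|->|_ _] //=; lia.
rewrite ac; apply/andP; split.
  case: tpermP => [_|//|//]; rewrite -(inj_eq val_inj) /=; lia.
apply/forallP=> d; apply/implyP=> cd; rewrite ffunE (ltn_trans ac cd) (inj_eq perm_inj).
by have := nc d; rewrite cd.
Qed.

Lemma hoist_fconnect a b z f : b.+1 = a :> nat -> tree f -> a < z ->
  fconnect f z a -> fconnect (hoist a b f) z b.
Proof.
move=> ba tf; rewrite /hoist; case: eqP => [<- _ za|/eqP ne].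
  by apply: connect_trans za _; apply: fconnect1.
elim: {z}(z : nat) {-2}z (leqnn z) => [|k IH] z zk az; first by lia.
rewrite fconnect_eqVf -(inj_eq val_inj) gtn_eqF //= => fza.
rewrite fconnect_eqVf; apply/orP; right; rewrite ffunE az.
have := fconnect_le tf fza; rewrite leq_eqVlt => /orP[/eqP/val_inj<-|afz].
  by rewrite tpermR connect0.
rewrite tpermD; last 2 first.
- by rewrite -(inj_eq val_inj) /=; lia.
- by rewrite -(inj_eq val_inj) /=; lia.
by apply: IH => //; have := tree_lt tf (ltn_trans _ az); lia.
Qed.

(** If [f a = b], then [a] is the largest child of [b], so the path from [z] to [b] enters [b]
    through [a]. Otherwise the path cannot meet [a], from which [b] is unreachable; it stays above
    [a] until its last step into [b], which the exchange turns into a step into [a]. *)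
Lemma hoist_fconnect_inv a b z f : b.+1 = a :> nat -> tree f -> a < z ->
  nonhead f a -> fconnect f z b -> fconnect (hoist a b f) z a.
Proof.
move=> ba tf az /andP[_ /forallP na].
have far : fconnect f a b -> f a = b.
  rewrite fconnect_eqVf -(inj_eq val_inj) /= gtn_eqF ?ba //= => fab.
  apply: val_inj; apply/eqP; rewrite eqn_leq (fconnect_le tf fab) andbT.
  have a0 : 0 < a by lia.
  by have := tree_lt tf a0; rewrite /=; lia.
elim: {z}(z : nat) {-2}z (leqnn z) az => [|k IH] z zk az; first by lia.
rewrite fconnect_eqVf -(inj_eq val_inj) /= gtn_eqF /=; last by lia.
move=> fzb; rewrite fconnect_eqVf; apply/orP; right.
have z0 : 0 < z by lia.
have fzk : f z <= k by have := tree_lt tf z0; lia.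
have IHz : a < f z -> fconnect (hoist a b f) (f z) a by move=> afz; apply: IH.
move: (fconnect_le tf fzb) IHz; rewrite /hoist leq_eqVlt => /orP[/eqP/val_inj ebf|bfz].
  case: eqP => [fab|ne] _; last by rewrite ffunE az -ebf tpermL connect0.
  by have := na z; rewrite az fab ebf eqxx.
have : a <= f z by lia.
rewrite leq_eqVlt => /orP[/eqP/val_inj eaf|afz].
  by rewrite far ?eqxx ?[in fconnect _ _ _]eaf // -eaf connect0.
move=> /(_ afz); case: eqP => // _ h; rewrite ffunE az tpermD //.
- by rewrite -(inj_eq val_inj) /=; lia.
- by rewrite -(inj_eq val_inj) /=; lia.
Qed.

(** The interval [(b, z]] is [(a, z]] with [a] added, so both sides put the same [nonhead]
    conditions on [f] and differ only in the prescribed ancestor. The injective map [hoist a b]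
    sends each side into the other. *)
Lemma card_reach_nonhead a b z : b.+1 = a :> nat -> a < z ->
  #|[set f in reach a z | nonhead f a]| = #|reach b z|.
Proof.
move=> ba az; apply/eqP; rewrite eqn_leq; apply/andP; split.
  rewrite -(card_imset _ (inv_inj (hoistK a b))).
  apply/subset_leq_card/subsetP => _ /imsetP[f fr ->]; move: fr.
  rewrite !inE => /andP[/and4P[tf lf /forallP nf cf] na].
  rewrite hoist_tree ?hoist_leaf ?hoist_fconnect //= andbT.
  apply/forallP=> c; apply/implyP=> /andP[bc cz]; apply: hoist_nonhead => //; first by lia.
  have : a <= c by lia.
  rewrite leq_eqVlt => /orP[/eqP/val_inj<- //|ac].
  by have := nf c; rewrite ac cz.
rewrite -(card_imset _ (inv_inj (hoistK a b))).
apply/subset_leq_card/subsetP => _ /imsetP[f fr ->]; move: fr.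
rewrite !inE => /and4P[tf lf /forallP nf cf].
have na : nonhead f a by have := nf a; rewrite -ba ltnSn ba (ltnW az).
rewrite hoist_tree ?hoist_leaf ?hoist_fconnect_inv ?hoist_nonhead //= !andbT.
apply/forallP=> c; apply/implyP=> /andP[ac cz]; apply: hoist_nonhead => //; first by lia.
by have := nf c; rewrite cz (_ : b < c) //; lia.
Qed.

(** Telescoping: the trees of [reach] at [k + 1] in which [k + 1] is not a first letter are as many
    as those of [reach] at [k]. *)
Lemma sum_reach_head z k : k < z ->
  \sum_(a : node | 0 < a <= k) #|[set f in reach a z | ~~ nonhead f a]|
    = #|reach (inord k) z|.
Proof.
elim: k => [|k IH] kz.
  rewrite big_pred0; last by move=> a; lia.
  (* The letter 1 has parent 0, hence is a first letter in [(0, z]], and the set for [a = 0] is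
     empty. *)
  apply/esym/eqP; rewrite cards_eq0; apply/eqP/setP=> f; rewrite !inE.
  apply/and4P=> -[tf _ /forallP nf _].
  have n1 : 1 < n.+1 by have := ltn_ord z; lia.
  have := nf (inord 1); rewrite !inordK // kz /=; case/andP => + _.
  rewrite -(inj_eq val_inj) /=; have := @tree_lt f (inord 1) tf.
  by rewrite inordK //; lia.
have kn : k.+1 < n.+1 by have := ltn_ord z; lia.
have kn' : k < n.+1 by lia.
rewrite (bigD1 (inord k.+1)) /=; last by rewrite inordK // leqnn.
rewrite (eq_bigl (fun a : node => 0 < a <= k)); last first.
  by move=> a; rewrite -(inj_eq val_inj) /= inordK //; lia.
rewrite IH; last by lia.
rewrite -(@card_reach_nonhead (inord k.+1) (inord k)) ?inordK //.
rewrite -[RHS](cardsID [set f | nonhead f (inord k.+1)]) addnC.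
by congr (_ + _); apply: eq_card => f; rewrite !inE // andbC.
Qed.

End Trees.

(** * Counting trees with a given leaf *)

Lemma card_ord_lt m k : k <= m -> #|[pred u : 'I_m | u < k]| = k.
Proof.
move=> km; rewrite -sum1_card (big_ord_narrow km).
by rewrite sum1_card card_ord.
Qed.

(** The letters below [z] contribute [(z-1)!], those above contribute [(n-2)! / (z-2)!]. *)
Lemma prod_choices z n : 1 < z <= n ->
  \prod_(0 <= c < n.+1)
     (if c < z then maxn 1 c else if c == z then 1 else c - 2)
  = z.-1 * (n.-2)`!.
Proof.
case/andP=> z1; elim: n => [|n IH]; first by lia.
rewrite leq_eqVlt => /orP[/eqP zn|zn].
  rewrite big_nat_recr //= -zn ltnn eqxx muln1.
  case: z z1 zn {IH} => // z z1 [<-] /=.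
  rewrite (eq_big_nat _ _ (F2 := fun c => maxn 1 c)); last by move=> c /andP[_ ->].
  rewrite big_nat_recl // mul1n -[z in RHS]prednK //.
  have -> : z.-1.+1 * (z.-1)`! = z`! by rewrite -factS prednK.
  rewrite fact_prod big_add1 /=.
  by apply: eq_bigr => i _; apply/maxn_idPr.
rewrite big_nat_recr //= IH //.
rewrite ltnNge (ltnW zn) /= gtn_eqF //.
case: n zn {IH} => [|[|n]] /= zn; [lia|lia|].
by rewrite factS subSS subSS subn0; lia.
Qed.

Section Count.
Variable n : nat.
Local Notation node := 'I_n.+1.
Implicit Types (f : {ffun node -> node}) (a b c d v x y z : node).

Lemma card_prod_family (F : node -> pred node) :
  #|(family F : pred {ffun node -> node})| = \prod_(c : node) #|F c|.
Proof. by rewrite card_family foldrE big_image. Qed.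

Lemma card_tree : #|[set f : {ffun node -> node} | tree f]| = n`!.
Proof.
rewrite (@eq_card _ _ (family (fun c : node => [pred v : node | v < maxn 1 c]))); last first.
  by move=> f; rewrite inE; apply/forallP/familyP.
rewrite card_prod_family (eq_bigr (fun c : node => maxn 1 c)); last first.
  by move=> c _; rewrite card_ord_lt //; have := ltn_ord c; lia.
rewrite big_ord_recl mul1n fact_prod big_add1 big_mkord.
by apply: eq_bigr => i _; rewrite lift0; apply/maxn_idPr.
Qed.

Lemma node_gtF c z : z < c -> (c == z) = false.
Proof. by rewrite -(inj_eq val_inj) /= => /gtn_eqF. Qed.

(** Once [f z = v] is fixed, being a leaf and continuing a run only forbid the values [z] and [v] at
    arguments [c > z], which leaves [c - 2] of the [c] values below [c]. The choices are
    independent. *)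
Lemma card_leaf_child v z : 0 < v < z ->
  #|[set f | [&& tree f, leaf f z, nonhead f z & f z == v]]| = z.-1 * (n.-2)`!.
Proof.
case/andP=> v0 vz; pose F c : pred node :=
  if c < z then [pred u : node | u < maxn 1 c] else
  if c == z then pred1 v else [pred u : node | [&& u != z, u != v & u < c]].
have F_lt c : c < z -> F c = [pred u : node | u < maxn 1 c] by rewrite /F => ->.
have F_eq : F z = pred1 v by rewrite /F ltnn eqxx.
have F_gt c : z < c -> F c = [pred u : node | [&& u != z, u != v & u < c]].
  by move=> zc; rewrite /F ltnNge (ltnW zc) (node_gtF zc).
rewrite (@eq_card _ _ (family F)); last first.
  move=> f; rewrite inE; apply/and4P/familyP=> [[tf lf nf fz] c|h].
    case: (ltngtP c z) => [cz|zc|/val_inj ->].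
    - by rewrite F_lt // inE (forallP tf).
    - rewrite F_gt // inE (forallP lf) /=.
      case/andP: nf => _ /forallP/(_ c); rewrite zc (eqP fz) /= => ->.
      by apply: tree_lt => //; lia.
    - by rewrite F_eq inE.
  have fz : f z = v by have := h z; rewrite F_eq => /eqP.
  have tf : tree f.
    apply/forallP=> c; have := h c; case: (ltngtP c z) => [cz|zc|/val_inj ->].
    - by rewrite F_lt.
    - by rewrite F_gt // inE => /and3P[_ _ h1]; apply: leq_trans h1 (leq_maxr _ _).
    - by rewrite fz; lia.
  split=> //; last by rewrite fz.
    apply/forallP=> c; have := h c; case: (ltngtP c z) => [cz _|zc|/val_inj -> _].
    - have := forallP tf c; rewrite -(inj_eq val_inj) /=; lia.
    - by rewrite F_gt // inE => /and3P[].
    - by rewrite fz -(inj_eq val_inj) /=; lia.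
  rewrite /nonhead fz -(inj_eq val_inj) /= -lt0n v0; apply/forallP=> d; apply/implyP=> zd.
  by have := h d; rewrite F_gt // inE => /and3P[].
rewrite card_prod_family -(@prod_choices z n); last by have := ltn_ord z; lia.
rewrite big_mkord; apply: eq_bigr => c _; case: (ltngtP c z) => [cz|zc|/val_inj ->].
- by rewrite F_lt // card_ord_lt //; have := ltn_ord c; lia.
- rewrite F_gt // -[X in X - 2](@card_ord_lt n.+1 c) 1?ltnW //.
  rewrite [in RHS](cardD1 v) [in RHS](cardD1 z) !inE zc (ltn_trans vz zc).
  rewrite (node_gtF vz) /= !add1n subSS subSS subn0.
  by apply: eq_card => u; rewrite !inE.
- by rewrite F_eq card1.
Qed.

(** The letter just below [z] is an ancestor of [z] only as its parent, so these are the trees of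
    [card_leaf_child] with [v = b]; for [b = 0] both sides vanish. *)
Lemma card_reach_pred b z : b.+1 = z :> nat -> #|reach b z| = z.-1 * (n.-2)`!.
Proof.
move=> bz; have [b0|b0] := posnP b.
  have -> : z.-1 = 0 by lia.
  have := @sum_reach_head n z 0; rewrite -bz ltn0Sn big_pred0; last by move=> a; lia.
  by move=> /(_ isT); have -> : inord 0 = b by apply: val_inj; rewrite /= inordK.
rewrite -(@card_leaf_child b z); last by lia.
apply: eq_card => f; rewrite !inE; apply/and4P/and4P=> -[tf lf nf cf]; split=> //.
- by have := forallP nf z; rewrite leqnn andbT -bz ltnSn.
- move: cf; rewrite fconnect_eqVf -(inj_eq val_inj) /= gtn_eqF; last by lia.
  move=> /(fconnect_le tf) bfz; rewrite -(inj_eq val_inj) /=.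
  by have := @tree_lt _ f z tf; lia.
- apply/forallP=> c; apply/implyP=> bcz.
  by have -> : c = z by apply: val_inj => /=; lia.
- by rewrite -(eqP cf) fconnect1.
Qed.

Lemma card_leaf_nonhead z : 0 < z ->
  #|[set f | [&& tree f, leaf f z & nonhead f z]]| = z.-1 * (z.-1 * (n.-2)`!).
Proof.
move=> z0; rewrite -sum1dep_card.
rewrite (partition_big (fun f => f z) (fun v : node => 0 < v < z)) /=; last first.
  move=> f /and3P[tf _ /andP[+ _]]; rewrite -(inj_eq val_inj) /=.
  by have := tree_lt tf z0; lia.
rewrite (eq_bigr (fun=> z.-1 * (n.-2)`!)); last first.
  move=> v vz; rewrite -(card_leaf_child vz) -sum1dep_card; apply: eq_bigl => f.
  by rewrite -!andbA.
rewrite sum_nat_const; congr (_ * _).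
have e := @card_ord_lt n.+1 z (ltnW (ltn_ord z)).
rewrite (cardD1 (ord0 : node)) inE z0 add1n in e; rewrite -[in RHS]e.
by apply: eq_card => v; rewrite !inE -(inj_eq val_inj) /= -lt0n.
Qed.

Lemma sum_reach_heads z : 0 < z ->
  \sum_(a : node | 0 < a < z) #|[set f in reach a z | ~~ nonhead f a]|
    = z.-1 * (n.-2)`!.
Proof.
move=> z0; have zn : z.-1 < n.+1 by have := ltn_ord z; lia.
rewrite -(@card_reach_pred (inord z.-1)); last by rewrite inordK // prednK.
rewrite -sum_reach_head; [apply: eq_bigl => a; lia | lia].
Qed.
End Count.

(** * From trees to words *)

Section Insert.
Variable T : eqType.
Implicit Types (v c x : T) (s : seq T).

Fixpoint insert_after v c s :=
  if s is x :: s' then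
    if x == v then x :: c :: s' else x :: insert_after v c s'
  else [::].

Lemma perm_insert_after v c s : v \in s -> perm_eq (insert_after v c s) (c :: s).
Proof.
elim: s => //= x s IH; rewrite inE eq_sym; case: eqP => [-> _|_ /= /IH h].
  exact: (permEl (perm_catCA [:: v] [:: c] s)).
apply: (@perm_trans _ (x :: c :: s)); first by rewrite perm_cons.
exact: (permEl (perm_catCA [:: x] [:: c] s)).
Qed.

Lemma insert_after_cons v c x s :
  insert_after v c (x :: s) = x :: behead (insert_after v c (x :: s)).
Proof. by rewrite /=; case: ifP. Qed.

Lemma rem_insert_after v c s : v \in s -> c \notin s ->
  rem c (insert_after v c s) = s.
Proof.
elim: s => //= x s IH; rewrite !inE negb_or eq_sym [c == x]eq_sym.
case: eqP => [-> _|_ /= vs] /andP[/negPf xc cs] /=; rewrite xc ?eqxx //.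
by rewrite IH.
Qed.

Lemma index_insert_after v c s : v \in s -> c \notin s ->
  index c (insert_after v c s) = (index v s).+1.
Proof.
elim: s => //= x s IH; rewrite !inE negb_or eq_sym [c == x]eq_sym.
case: eqP => [-> _|_ /= vs] /andP[/negPf xc cs] /=; rewrite xc ?eqxx //.
by rewrite IH.
Qed.

(** The insertion breaks one adjacency, from [v] to its successor [y], and creates those of [v, c]
    and [c, y]; all others start at a letter other than [v]. *)
Lemma path_insert_after (e e' : rel T) v c x s :
    v \in x :: s -> uniq (x :: s) -> path e x s ->
    (forall y z, y != v -> e y z -> e' y z) -> e' v c ->
    (forall y, y \in s -> e v y -> e' c y) ->
  path e' x (behead (insert_after v c (x :: s))).
Proof.
move=> + + + ee' evc; elim: s x => [|y s IH] x vs.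
  by move: vs; rewrite inE => /eqP <- _ _ _ /=; rewrite eqxx /= evc.
move=> /andP[xs us] /andP[exy pys] ecy; move: vs; rewrite inE eq_sym.
case: eqP => [xv _|/eqP xv]; last rewrite orFb => vs.
  subst x; rewrite /= eqxx /= evc ecy ?inE ?eqxx //=.
  apply: sub_in_path pys; last exact: allss.
  move=> z1 z2 z1s _ /=; apply: ee'; apply: contraNneq xs => <-.
  by rewrite inE in z1s *.
have -> : insert_after v c [:: x, y & s] = x :: insert_after v c (y :: s).
  by rewrite [LHS]/= (negPf xv).
rewrite insert_after_cons /= ee' //=; apply: IH => // z zs.
by apply: ecy; rewrite inE zs orbT.
Qed.

Lemma last_insert_after v c x s : v \in x :: s -> uniq (x :: s) ->
  last x (behead (insert_after v c (x :: s))) =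
    if last x s == v then c else last x s.
Proof.
elim: s x => [|y s IH] x; first by rewrite inE /= => /eqP ->; rewrite eqxx.
move=> vs /= /andP[xs us]; move: vs; rewrite inE eq_sym.
case: eqP => [xv _|/eqP xv]; last rewrite orFb => vs.
  case: eqP => e; first by rewrite xv -e mem_last in xs.
  by [].
by rewrite -(IH y vs us) /=; case: ifP.
Qed.

End Insert.

Section Word.
Variable n : nat.
Local Notation node := 'I_n.+1.
Implicit Types (f g : {ffun node -> node}) (a b c d v x y z : node).

(** Letters enter in increasing order, so for a tree only larger letters ever come between [f c] and
    [c]: the nearest smaller letter to the left of [c] remains [f c]. *)
Fixpoint tree_word f k : seq node :=
  if k is k'.+1 then insert_after (f (inord k)) (inord k) (tree_word f k')
  else [:: ord0].

Lemma tree_wordP f k : tree f -> k <= n ->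
  uniq (tree_word f k) /\ (forall x, (x \in tree_word f k) = (x <= k)).
Proof.
move=> tf; elim: k => [|k IH] kn.
  by split=> // x; rewrite inE -(inj_eq val_inj) /= leqn0.
have [u m] := IH (ltnW kn).
have ck : (inord k.+1 : node) = k.+1 :> nat by rewrite inordK.
have p : perm_eq (tree_word f k.+1) (inord k.+1 :: tree_word f k).
  apply: perm_insert_after; rewrite m.
  by have := @tree_lt _ f (inord k.+1) tf; lia.
split; first by rewrite (perm_uniq p) /= u m ck ltnn.
move=> x; rewrite (perm_mem p) inE m -(inj_eq val_inj) /= ck; lia.
Qed.

Lemma tree_word_cons f k : tree_word f k = ord0 :: behead (tree_word f k).
Proof.
elim: k => //= k ->; rewrite insert_after_cons //.
Qed.

(** The largest letter reveals its parent as its left neighbour, and its removal gives back the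
    previous word. *)
Lemma tree_word_inj f g : tree f -> tree g ->
  tree_word f n = tree_word g n -> f = g.
Proof.
move=> tf tg; suff H k : k <= n -> tree_word f k = tree_word g k ->
    forall x, x <= k -> f x = g x.
  by move=> e; apply/ffunP => x; apply: (H n) => //; rewrite -ltnS.
elim: k => [|k IH] kn e x xk.
  have -> : x = ord0 by apply: val_inj => /=; lia.
  by rewrite !tree0.
have [_ mf] := tree_wordP tf (ltnW kn); have [_ mg] := tree_wordP tg (ltnW kn).
have ck : (inord k.+1 : node) = k.+1 :> nat by rewrite inordK.
have lf : f (inord k.+1) \in tree_word f k.
  by rewrite mf; have := @tree_lt _ f (inord k.+1) tf; lia.
have lg : g (inord k.+1) \in tree_word g k.
  by rewrite mg; have := @tree_lt _ g (inord k.+1) tg; lia.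
have cf : inord k.+1 \notin tree_word f k by rewrite mf ck ltnn.
have cg : inord k.+1 \notin tree_word g k by rewrite mg ck ltnn.
have e' : tree_word f k = tree_word g k.
  by rewrite -(rem_insert_after lf cf) -(rem_insert_after lg cg); congr rem.
move: xk; rewrite leq_eqVlt => /orP[/eqP xk|]; last by apply: IH => //; rewrite ltnW.
have -> : x = inord k.+1 by apply: val_inj; rewrite /= ck.
have := index_insert_after lf cf; rewrite [insert_after _ _ _]e.
rewrite (index_insert_after lg cg) => -[]; rewrite e' => ei.
by rewrite -[LHS](@nth_index _ ord0 _ (tree_word g k)) -?e' // e' -ei nth_index.
Qed.

(** Starting at [d = 1] discards [f 0 = 0], so that the root counts as a leaf of the one-letter
    word. *)
Definition leaf_upto f k z := [forall d : node, (0 < d <= k) ==> (f d != z)].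

(** Adjacency in the word on letters up to [k]: at an ascent [y] is the largest child of [x] so far,
    at a descent [x] is a leaf so far and [y] has a larger sibling. *)
Definition follows f k : rel node := fun x y =>
  if x < y then (f y == x) && [forall d : node, (y < d <= k) ==> (f d != x)]
  else leaf_upto f k x && [exists d : node, (y < d <= k) && (f d == f y)].

(** The new letter [c] is a leaf and the largest child of [f c]. If the old successor [y] of [f c]
    was its largest child, [c] is now a larger sibling of [y]; otherwise [y] already had a larger
    sibling. *)
Lemma tree_word_path f k : tree f -> k <= n ->
  path (follows f k) ord0 (behead (tree_word f k))
  /\ leaf_upto f k (last ord0 (behead (tree_word f k))).
Proof.
move=> tf; elim: k => [|k IH] kn.
  by split=> //; apply/forallP=> d; apply/implyP; lia.
have [p l] := IH (ltnW kn).
have ck : (inord k.+1 : node) = k.+1 :> nat by rewrite inordK.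
have [u m] := tree_wordP tf (ltnW kn).
set c : node := inord k.+1 in ck *.
have fc : f c < c by apply: tree_lt => //; lia.
have fcm : f c \in tree_word f k by rewrite m; lia.
have lc : leaf_upto f k.+1 c.
  apply/forallP=> d; apply/implyP=> /andP[d0 dk]; rewrite -(inj_eq val_inj) /=.
  by have := tree_lt tf d0; lia.
have dc d : d <= k.+1 -> (d <= k) || (d == c).
  by rewrite -(inj_eq val_inj) /=; lia.
have ext x : x != f c -> leaf_upto f k x -> leaf_upto f k.+1 x.
  move=> xv /forallP h; apply/forallP=> d; apply/implyP=> /andP[d0 /dc].
  by case/orP => [dk|/eqP->]; [have := h d; rewrite d0 dk | rewrite eq_sym].
have -> : tree_word f k.+1 = insert_after (f c) c (tree_word f k) by [].
rewrite tree_word_cons in m u fcm *; split; last first.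
  by rewrite last_insert_after //; case: eqP => // /eqP /ext; apply.
apply: path_insert_after p _ _ _ => //.
- move=> x y xv; rewrite /follows; case: ifP => [_ /andP[-> /forallP h]|_ /andP[/ext-> //]].
    apply/forallP=> d; apply/implyP=> /andP[d0 /dc].
    by case/orP => [dk|/eqP->]; [have := h d; rewrite d0 dk | rewrite eq_sym].
  case/existsP=> d /andP[/andP[yd dk] e]; apply/existsP; exists d.
  by rewrite yd e (leqW dk).
- rewrite /follows fc eqxx; apply/forallP=> d; apply/implyP; lia.
move=> y ys; have := m y; rewrite inE ys orbT => /esym yk.
have cy : (c < y) = false by lia.
rewrite /follows cy lc /=.
case: ifP => [vy /andP[/eqP fy _]|_ /andP[_ /existsP[d /andP[/andP[yd dk] e]]]].
  by apply/existsP; exists c; rewrite fy eqxx; lia.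
by apply/existsP; exists d; rewrite yd e (leqW dk).
Qed.

End Word.

Lemma perm_min_size (T : eqType) (s1 s2 : seq T) :
  uniq s1 -> uniq s2 -> {subset s1 <= s2} -> size s2 <= size s1 -> perm_eq s1 s2.
Proof.
by move=> u1 u2 sub le; apply: uniq_perm => //; have [] := uniq_min_size u1 sub le.
Qed.

(** * Runs of the word of a tree *)

Section TreeRuns.
Variable n : nat.
Local Notation node := 'I_n.+1.
Implicit Types (f g : {ffun node -> node}) (a b c d v x y z : node).
Implicit Types (w r : seq node).

Definition extends f : rel node := fun x y => (f y == x) && nonhead f y.

Definition extends_or_breaks f : rel node := fun x y =>
  if x < y then extends f x y else leaf f x && ~~ nonhead f y.

Definition chain f r :=
  path (extends f) (head ord0 r) (behead r) && leaf f (last ord0 r).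

Lemma runs_chain f w : sorted (extends_or_breaks f) w -> leaf f (last ord0 w) ->
  all (chain f) (runs w) /\
  all (fun r => ~~ nonhead f (head ord0 r)) (behead (runs w)).
Proof.
elim: w => //= x [|y w] IH; first by rewrite /chain /= => _ ->.
case/andP=> xy pyw /(IH pyw) {IH}.
have := flatten_runs (y :: w); have := runs_neq_nil (y :: w).
case: (runs (y :: w)) => [|[|y' r] rs] //= _ [-> _] [/andP[cr crs] hrs].
move: xy; rewrite /extends_or_breaks ltEord; case: ifP => _ => [e|/andP[lx hy]].
  by split=> //=; rewrite crs andbT; move: cr; rewrite /chain /= e.
by rewrite /= cr crs hy hrs /chain /= lx.
Qed.

Lemma leaf_uptoP f z : tree f -> 0 < z -> leaf_upto f n z -> leaf f z.
Proof.
move=> tf z0 /forallP h; apply/forallP=> d; have [d0|d0] := posnP d.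
  have -> : d = ord0 by apply: val_inj.
  by rewrite tree0 // -(inj_eq val_inj) /=; lia.
by have := h d; rewrite d0 /= -ltnS ltn_ord.
Qed.

Lemma follows_extends f x y : tree f -> 0 < x -> follows f n x y ->
  extends_or_breaks f x y.
Proof.
move=> tf x0; rewrite /follows /extends_or_breaks /extends /nonhead.
case: ifP => [xy /andP[/eqP -> /forallP h]|xy /andP[lx /existsP[d /andP[/andP[yd _] e]]]].
  rewrite eqxx -(inj_eq val_inj) /= -lt0n x0 /=; apply/forallP=> d.
  by apply/implyP=> yd; have := h d; rewrite yd /= -ltnS ltn_ord.
rewrite (leaf_uptoP tf x0 lx) negb_and; apply/orP; right.
by apply/forallPn; exists d; rewrite yd e.
Qed.

Lemma mem_tree_word f x : tree f -> (x \in behead (tree_word f n)) = (0 < x).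
Proof.
move=> tf; have [u m] := tree_wordP tf (leqnn n).
rewrite tree_word_cons in u m; move: u => /= /andP[u _].
have := m x; rewrite -ltnS ltn_ord inE.
have [x0|x0] := posnP x.
  by have -> : x = ord0 by [apply: val_inj]; rewrite (negPf u).
by rewrite -(inj_eq val_inj) /= gtn_eqF.
Qed.

Lemma uniq_tree_word f : tree f -> uniq (behead (tree_word f n)).
Proof.
move=> tf; have [+ _] := tree_wordP tf (leqnn n).
by rewrite tree_word_cons => /andP[].
Qed.

Lemma runs_tree_word f : tree f ->
  all (chain f) (runs (behead (tree_word f n))) /\
  all (fun r => ~~ nonhead f (head ord0 r)) (runs (behead (tree_word f n))).
Proof.
move=> tf; have [p l] := tree_word_path tf (leqnn n).
have m x := @mem_tree_word f x tf.
case E: (behead (tree_word f n)) p l m => [|y w] //= /andP[fy pw] l m.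
have m0 : all (fun x : node => 0 < x) (y :: w).
  by apply/allP=> x xw; rewrite -m.
have y0 : 0 < y by case/andP: m0.
(* The first letter follows the sentinel at an ascent, so its parent is the root. *)
have hy : ~~ nonhead f y.
  by move: fy; rewrite /follows y0 /nonhead => /andP[-> _].
have s : sorted (extends_or_breaks f) (y :: w).
  by apply: (sub_in_sorted _ m0 pw) => x z x0 _; apply: follows_extends.
have ll : leaf f (last ord0 (y :: w)).
  by apply: leaf_uptoP l => //; rewrite -m mem_last.
have [c h] := runs_chain s ll; split=> //.
change (all (fun r => ~~ nonhead f (head ord0 r)) (runs (y :: w))).
have := flatten_runs (y :: w); have := runs_neq_nil (y :: w); move: h.
by case: (runs (y :: w)) => [|[|y' r] rs] //= h _ [-> _]; rewrite hy.
Qed.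

Lemma chain_fconnect f h t a : path (extends f) h t ->
  fconnect f (last h t) a -> (a \in t) || fconnect f h a.
Proof.
elim: t h => [|y t IH] h //= /andP[/andP[/eqP fy _] p] /(IH _ p).
rewrite inE => /orP[->|]; first by rewrite orbT.
by rewrite fconnect_eqVf fy eq_sym -orbA => /orP[->//|->]; rewrite !orbT.
Qed.

Lemma fconnect_chain f h t : path (extends f) h t -> fconnect f (last h t) h.
Proof.
elim: t h => [|y t IH] h /=; first by rewrite connect0.
case/andP=> /andP[/eqP <- _] /IH p; exact: connect_trans p (fconnect1 _ _).
Qed.

Lemma chain_nonhead f h t : path (extends f) h t -> all (nonhead f) t.
Proof. by elim: t h => //= y t IH h /andP[/andP[_ ->] /IH]. Qed.

(** Let [h] be the head of [r]. The ancestors of [z] are letters of the run or ancestors of [h], so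
    a first letter among them is at most [h]; if it is smaller, [h] violates the condition on
    [(a, z]]. Only [a = h] can contribute, and it does exactly when no head lies strictly between
    [h] and [z]. *)
Lemma run_balance f r (w := behead (tree_word f n)) (z := last ord0 r) :
  tree f -> r \in runs w ->
  straddled ord0 (runs w) r
    + \sum_(a : node | 0 < a < z) ((f \in reach a z) && ~~ nonhead f a)
    = nonhead f z.
Proof.
move=> tf rw; have [/allP cw /allP hw] := runs_tree_word tf.
have /andP[] := cw _ rw; have := hw _ rw.
have : r != [::] by apply: (allP (runs_neq_nil w)).
have h0 : head ord0 r \in w.
  rewrite -(flatten_runs w); apply/flattenP; exists r => //; apply: head_mem.
  exact: (allP (runs_neq_nil w)).
have heads b : ~~ nonhead f b -> 0 < b -> exists2 r', r' \in runs w & head ord0 r' = b.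
  move=> nb b0; have : b \in w by rewrite mem_tree_word.
  rewrite -{1}(flatten_runs w) => /flattenP[r' r'w br']; exists r' => //.
  have /andP[+ _] := cw _ r'w; case: r' br' {r'w} => //= h t.
  rewrite inE => /orP[/eqP->//|bt] /chain_nonhead/allP/(_ _ bt).
  by rewrite (negPf nb).
rewrite /z /straddled {z}; case: r rw h0 => // h t rw; rewrite /= mem_tree_word //.
set z := last h t => h0 _ nh pht lz.
have zh := fconnect_chain pht; rewrite -/z in zh.
have hz := fconnect_le tf zh.
have small a : fconnect f z a -> ~~ nonhead f a -> a <= h.
  move=> /(chain_fconnect pht)/orP[at_ /negP[]|/(fconnect_le tf) //].
  exact: (allP (chain_nonhead pht)).
have reachP a : 0 < a < z -> (f \in reach a z) && ~~ nonhead f a -> a = h.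
  case/andP=> a0 az /andP[+ na]; rewrite inE => /and4P[_ _ /forallP nc za].
  apply: val_inj; apply/eqP; rewrite /= eqn_leq small //= leqNgt; apply/negP=> ah.
  by have := nc h; rewrite ah hz (negPf nh).
(* In a one-letter run all three terms are zero. *)
have [zh0|hz'] := eqVneq z h.
  rewrite zh0 (negPf nh) big1 ?addn0.
    apply/eqP; rewrite eqb0; apply/hasPn=> r' _; apply/negP=> /andP[].
    by rewrite !ltEord /=; lia.
  move=> a /andP[a0 ah]; apply/eqP; rewrite eqb0; apply/negP => ha.
  by have := reachP a; rewrite zh0 a0 ah => /(_ isT ha) e; rewrite e ltnn in ah.
have {}hz : h < z by rewrite ltn_neqAle hz andbT eq_sym.
have nz : nonhead f z.
  apply: (allP (chain_nonhead pht)); move: hz'; rewrite /z.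
  by case: (t) => [|y t']; rewrite ?eqxx //= mem_last.
rewrite (bigD1 h) ?h0 //= big1 ?addn0; last first.
  move=> a /andP[a0z ah]; apply/eqP; rewrite eqb0; apply/negP => /(reachP _ a0z) e.
  by rewrite e eqxx in ah.
rewrite nz nh andbT inE tf lz zh andbT /=.
case: hasP => [[r' r'w]|nohead].
  rewrite !ltEord => /andP[lt1 lt2]; rewrite (_ : [forall c, _] = false) //.
  apply/forallP=> /(_ (head ord0 r')); rewrite lt1 (ltnW lt2) /=.
  by rewrite (negPf (hw _ r'w)).
rewrite (_ : [forall c, _]) //; apply/forallP=> c; apply/implyP=> /andP[hc cz].
apply/negPn/negP=> nc; have [|r' r'w e] := heads c nc; first by lia.
case: nohead; exists r' => //; rewrite !ltEord /= e hc ltn_neqAle cz andbT.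
by apply: contraNneq nc => /val_inj ->.
Qed.

(** A leaf must close its run, since the next letter of the run would be its child; conversely every
    run ends at a leaf. *)
Lemma sum_last_runs f (G : node -> nat) (w := behead (tree_word f n)) : tree f ->
  \sum_(r <- runs w) G (last ord0 r) = \sum_(z : node | leaf f z) G z.
Proof.
move=> tf; have [/allP cw _] := runs_tree_word tf.
rewrite -(big_map (last ord0) xpredT).
transitivity (\sum_(z <- enum [pred z | leaf f z]) G z); last by rewrite big_enum.
apply: perm_big; apply: uniq_perm; rewrite ?enum_uniq //.
  apply: uniq_flatten_map => [|r /(allP (runs_neq_nil w))]; last exact: last_mem.
  by rewrite flatten_runs uniq_tree_word.
move=> z; rewrite mem_enum inE; apply/mapP/idP=> [[r rw ->]|lz].
  by case/andP: (cw _ rw).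
have : z \in w by rewrite mem_tree_word // (leaf_gt0 tf lz).
rewrite -{1}(flatten_runs w) => /flattenP[r rw zr]; exists r => //.
have /andP[+ _] := cw _ rw; case: r zr {rw} => // h t /=.
elim: t h => [|y t IH] h; first by rewrite inE => /eqP.
rewrite inE => /orP[/eqP <-|zt] /= /andP[/andP[/eqP fy _] p]; last exact: IH.
by have := forallP lz y; rewrite fy eqxx.
Qed.

Lemma tree_balance f (w := behead (tree_word f n)) : tree f ->
  count (straddled ord0 (runs w)) (runs w)
    + \sum_(z : node) \sum_(a : node | 0 < a < z) ((f \in reach a z) && ~~ nonhead f a)
  = \sum_(z : node) (leaf f z && nonhead f z).
Proof.
move=> tf; rewrite -sum1_count big_mkcond.
rewrite [X in _ + X](_ : _ = \sum_(z : node | leaf f z)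
  \sum_(a : node | 0 < a < z) ((f \in reach a z) && ~~ nonhead f a)); last first.
  rewrite [RHS]big_mkcond; apply: eq_bigr => z _; case: ifP => // lz.
  by apply: big1 => a _; rewrite inE lz andbF.
rewrite -sum_last_runs // -big_split /=.
rewrite [RHS](_ : _ = \sum_(z : node | leaf f z) (nonhead f z : nat)); last first.
  by rewrite [RHS]big_mkcond; apply: eq_bigr => z _; case: leaf.
rewrite -sum_last_runs // big_seq [RHS]big_seq; apply: eq_bigr => r rw.
by rewrite -run_balance //; case: straddled.
Qed.

Lemma lift0_mono : {mono (lift ord0 : 'I_n -> node) : x y / (x < y)%O}.
Proof. by move=> x y; rewrite !ltEord. Qed.

(** Both sides list distinct rearrangements of the letters 1 to [n], and there are [n!] of each, so
    both exhaust [permutations L]. No inverse of [tree_word] has to be built. *)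
Lemma sum_perm_words (X : seq node -> nat) :
  \sum_(s : 'S_n) X (map (lift ord0) (oneline s))
    = \sum_(f : {ffun node -> node} | tree f) X (behead (tree_word f n)).
Proof.
pose L := [seq lift ord0 i | i <- enum 'I_n].
have uL : uniq L by rewrite map_inj_uniq ?enum_uniq //; apply: lift_inj.
have memL x : (x \in L) = (0 < x).
  apply/mapP/idP => [[i _ ->] //|x0]; case: (unliftP ord0 x) x0 => [j ->|->] // _.
  by exists j; rewrite ?mem_enum.
have sP : size (permutations L) = n`!.
  by rewrite size_permutations // size_map size_enum_ord.
pose S := [seq map (lift ord0) (oneline s) | s : 'S_n].
pose F := [seq behead (tree_word f n) | f <- enum [pred f | tree f]].
have pS : perm_eq S (permutations L).
  apply: perm_min_size (permutations_uniq _) _ _.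
  - rewrite map_inj_uniq ?enum_uniq // => s t.
    move/(inj_map (@lift_inj _ _)) => e; apply/permP=> i.
    by rewrite -[s i]tnth_mktuple -[t i]tnth_mktuple; congr tnth; apply: val_inj.
  - move=> _ /mapP[s _ ->]; rewrite mem_permutations; apply: perm_map.
    apply: uniq_perm; rewrite ?enum_uniq ?uniq_oneline // => i.
    rewrite mem_enum; apply/mapP; exists ((s^-1)%g i); rewrite ?mem_enum //.
    by rewrite permKV.
  - by rewrite sP size_map -cardE card_Sn.
have pF : perm_eq F (permutations L).
  apply: perm_min_size (permutations_uniq _) _ _.
  - rewrite map_inj_in_uniq ?enum_uniq // => f g; rewrite !mem_enum => tf tg e.
    by apply: tree_word_inj => //; rewrite tree_word_cons e -tree_word_cons.
  - move=> _ /mapP[f + ->]; rewrite mem_enum => tf; rewrite mem_permutations.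
    apply: uniq_perm; rewrite ?uniq_tree_word // => x.
    by rewrite mem_tree_word // memL.
  - rewrite sP size_map -cardE -(card_tree n) subset_leq_card //.
    by apply/subsetP=> f; rewrite inE.
transitivity (\sum_(w <- permutations L) X w).
  by rewrite -(perm_big _ pS) /= big_image.
by rewrite -(perm_big _ pF) /= big_map big_enum.
Qed.

(** This is [tree_balance] summed over all trees, with [i = z - 1]; the negative term is kept on the
    left to stay within the naturals. *)
Lemma sum_des_runsort : 0 < n ->
  \sum_(s : 'S_n) des (runsort s) + \sum_(i < n) i * (n.-2)`!
    = \sum_(i < n) i * (i * (n.-2)`!).
Proof.
move=> n0.
rewrite (eq_bigr (fun s : 'S_n => (fun w => count (straddled ord0 (runs w)) (runs w))
   (map (lift ord0) (oneline s)))); last first.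
  move=> s _; pose x0 : 'I_n := cast_ord (prednK n0) ord0.
  rewrite (des_runsort x0) (runs_map lift0_mono).
  by rewrite (count_straddled_map lift0_mono x0) // runs_neq_nil.
rewrite (sum_perm_words (fun w => count (straddled ord0 (runs w)) (runs w))).
have zE (G : nat -> nat) : \sum_(i < n) G i = \sum_(z : node | 0 < z) G z.-1.
  by rewrite [RHS]big_mkcond big_ord_recl /= add0n.
rewrite (zE (fun i => i * _)) (zE (fun i => i * (i * _))).
rewrite (eq_bigr (fun z : node => \sum_(a : node | 0 < a < z)
    #|[set f in reach a z | ~~ nonhead f a]|)); last first.
  by move=> z z0; rewrite sum_reach_heads.
rewrite [RHS](eq_bigr (fun z : node =>
  #|[set f : {ffun node -> node} | [&& tree f, leaf f z & nonhead f z]]|)); last first.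
  by move=> z z0; rewrite card_leaf_nonhead.
(* Pairs of a tree and a letter are counted in the other order; the root is never a leaf, so [z = 0]
   adds nothing. *)
rewrite [RHS](_ : _ = \sum_(f : {ffun node -> node} | tree f)
    \sum_(z : node) (leaf f z && nonhead f z)); last first.
  rewrite exchange_big /= [RHS](bigID (fun z : node => 0 < z)) /=.
  rewrite [X in _ = _ + X]big1 ?addn0 => [|z z0]; last first.
    apply: big1 => f tf; apply/eqP; rewrite eqb0; apply: contra z0.
    by case/andP=> /(leaf_gt0 tf).
  apply: eq_bigr => z _; rewrite -sum1dep_card big_mkcondr /=.
  by apply: eq_bigr => f _; case: ifP.
rewrite [X in _ + X](_ : _ = \sum_(f : {ffun node -> node} | tree f)
    \sum_(z : node) \sum_(a : node | 0 < a < z) ((f \in reach a z) && ~~ nonhead f a)); last first.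
  rewrite exchange_big /= [RHS](bigID (fun z : node => 0 < z)) /=.
  rewrite [X in _ = _ + X]big1 ?addn0 => [|z z0]; last first.
    by apply: big1 => f tf; apply: big_pred0 => a; lia.
  apply: eq_bigr => z _; rewrite exchange_big /=; apply: eq_bigr => a _.
  rewrite -sum1dep_card big_mkcond [RHS]big_mkcond /=; apply: eq_bigr => f _.
  by rewrite [f \in _]inE; case: (tree f) => //=; case: ifP.
by rewrite -big_split /=; apply: eq_bigr => f tf; apply: tree_balance.
Qed.

End TreeRuns.

(** * Evaluation of the sums and expectations *)

Lemma sum_squares m :
  3 * (\sum_(i < m.+2) i * i) = 3 * (\sum_(i < m.+2) i) + m * m.+1 * m.+2.
Proof.
elim: m => [|m IH]; first by rewrite !big_ord_recr !big_ord0.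
rewrite big_ord_recr [in RHS]big_ord_recr /= mulnDr IH.
by move: (\sum_(i < m.+2) i) => A; nia.
Qed.

Lemma sum_des_runsort_closed m :
  3 * \sum_(s : 'S_m.+2) des (runsort s) = m * (m.+2)`!.
Proof.
have := @sum_des_runsort m.+2 isT; have := sum_squares m.
have -> : \sum_(i < m.+2) i * (i * m.+2.-2`!) = (\sum_(i < m.+2) i * i) * m`!.
  by rewrite big_distrl; apply: eq_bigr => i _; rewrite mulnA.
rewrite /= -big_distrl /= !factS.
move: (\sum_(i < m.+2) i) (\sum_(i < m.+2) i * i) (\sum_s _) (m`!) => A B D F.
(* The identity for squares is scaled by [F], which stands for the factorial of [m], to match the
   terms of [eD]. *)
by move=> eB eD; have := congr1 (fun k => k * F) eB; nia.
Qed.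

Local Open Scope ring_scope.

Theorem theorem4p20 (n : nat) (hn : (2 <= n)%N) :
  [/\ expect (fun s : 'S_n => des (runsort s))
        = expect (fun s : 'S_n => peaks (runsort s)),
      expect (fun s : 'S_n => peaks (runsort s))
        = expect (fun s : 'S_n => peaks s) &
      expect (fun s : 'S_n => peaks s) = (n%:R - 2) / 3].
Proof.
case: n hn => [|[|m]] // _.
have E (X : 'S_m.+2 -> nat) : (3 * \sum_s X s = m * (m.+2)`!)%N ->
    expect X = (m.+2%:R - 2) / 3.
  move=> /(congr1 (fun k => k%:R : rat)); rewrite natrM [in RHS]natrM natr_sum => e.
  have f0 : (m.+2)`!%:R != 0 :> rat by rewrite pnatr_eq0 -lt0n fact_gt0.
  rewrite /expect cardsT card_Sn; apply: (canLR (mulfK f0)).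
  apply: (@mulfI _ 3) => //; rewrite e.
  have -> : m.+2%:R - 2 = m%:R :> rat by rewrite -addn2 natrD addrK.
  by move: (_`!%:R) => F; field.
have D := E _ (sum_des_runsort_closed m); have P := E _ (sum_peaks m).
have DP : expect (fun s : 'S_m.+2 => peaks (runsort s))
        = expect (fun s : 'S_m.+2 => des (runsort s)).
  by congr (_ / _); apply: eq_bigr => s _; rewrite peaks_runsort.
by split; rewrite ?DP ?D ?P.
Qed.
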